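(* Let $D\subseteq W$ be a closed Condorcet domain. Then $D$ is of tiling type if and only if $D$ is connected, of maximal width, and maximal, with $e,w_0\in D$.
   Context: Let $\Phi$ be a finite root system in a real Euclidean space (a finite set of nonzero vectors with $\Phi\cap\mathbb{R}\alpha=\{\alpha,-\alpha\}$ and $s_\alpha(\Phi)=\Phi$ for all $\alpha\in\Phi$, where $s_\alpha$ is the orthogonal reflection in $\alpha^\perp$; not necessarily crystallographic). Let $\Phi^+$ be a choice of positive roots, $\Phi^-=\Phi\setminus\Phi^+$, and let $W=W(\Phi)$ be the finite Coxeter group generated by the $s_\alpha$, with identity $e$ and set of simple reflections $S=\{s_1,\dots,s_n\}$ (reflections in the simple roots of $\Phi^+$). For $w\in W$, the (left) inversion set is $I(w):=\{\alpha\in\Phi\mid w^{-1}\alpha\in\Phi^-\}$ (negative roots are allowed, so exactly one of $\alpha,-\alpha$ lies in $I(w)$). The longest element $w_0$ is the unique element with $I(w_0)=\Phi^+$. A set of three roots $\{\alpha,\beta,\gamma\}\subseteq\Phi$ is a root-triple if there exist real $a,b,c>0$ with $a\alpha+b\beta+c\gamma=0$. A nonempty subset $D\subseteq W$ is a Condorcet domain if there do not exist distinct $u,v,w\in D$ and a root-triple $\{\alpha,\beta,\gamma\}$ such that $\alpha,\beta\in I(u)$, $\alpha,\gamma\in I(v)$, $\beta,\gamma\in I(w)$. A Condorcet domain is maximal if it is not properly contained in another Condorcet domain in $W$. A voting profile on $D$ is a map $f:D\to\mathbb{Z}_{\ge0}$, not constantly zero. Put $f(\alpha)=\sum_{w\in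 D,\ \alpha\in I(w)}f(w)$ for $\alpha\in\Phi$, $|f|=\sum_{w\in D}f(w)$, $I(f)=\{\alpha\in\Phi\mid f(\alpha)\ge|f|/2\}$ and $R(f)=\{w\in W\mid I(w)\subseteq I(f)\}$. $f$ has no tie if $f(\alpha)\ne|f|/2$ for all $\alpha\in\Phi$. Let $\nu(D)=\bigcup_f R(f)$ over all voting profiles $f$ on $D$ with no tie. A Condorcet domain $D$ is closed if $\nu(D)=D$ (equivalently $\nu(D)\subseteq D$). $D$ is connected if for any $u,v\in D$ there exist $m\ge0$ and a sequence $u_0=u,u_1,\dots,u_m=v$ in $D$ with $|I(u_{i+1})\setminus I(u_i)|=1$ for all $0\le i\le m-1$. $D$ is of maximal width if there is at least one $v\in D$ with $vw_0\in D$. A reduced word for $w\in W$ is a sequence $(s_{i_1},\dots,s_{i_m})$ of simple reflections with $w=s_{i_1}\cdots s_{i_m}$ and $m$ minimal. The commutation class $C(\mathbf{i})$ of a reduced word $\mathbf{i}$ is the set of reduced words obtained from $\mathbf{i}$ by sequences of exchanges of adjacent generators $s_i,s_j$ with $s_is_j=s_js_i$. A nonempty subset $D\subseteq W$ is of tiling type if there is a reduced word $\mathbf{i}$ for $w_0$, of length $m$, such that $D=\{s_{i'_1}s_{i'_2}\cdots s_{i'_l}\mid(s_{i'_1},\dots,s_{i'_m})\in C(\mathbf{i}),\ 0\le l\le m\}$. *)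

(* Defs.v *)
From mathcomp Require Import all_boot all_order all_algebra finmap reals.

Set Implicit Arguments.
Unset Strict Implicit.
Unset Printing Implicit Defensive.

Import Order.TTheory GRing.Theory Num.Theory.

Local Open Scope fset_scope.
Local Open Scope ring_scope.

(* The Euclidean space is R^d, as column vectors with the standard inner
   product.  Matrices act on the left, so u *m v is "first v, then u" and
   products of reflections are read as in w = s_1 s_2 ... s_m. *)
Definition dot (R : realType) (d : nat) (x y : 'cV[R]_d) : R :=
  \sum_(i < d) x i 0 * y i 0.

(* The matrix of  x |-> x - (2 <a, x> / <a, a>) a. *)
Definition refl (R : realType) (d : nat) (a : 'cV[R]_d) : 'M[R]_d :=
  1%:M - (2 / dot a a) *: (a *m a^T).

Definition root_system (R : realType) (d : nat) (Phi : {fset 'cV[R]_d}) : Prop :=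
  [/\ 0 \notin Phi,
      forall a, a \in Phi ->
        forall b, (b \in Phi /\ exists c : R, b = c *: a) <-> (b = a \/ b = - a)
    & forall a, a \in Phi -> [fset refl a *m b | b in Phi] = Phi].

(* The roots on the positive side of a hyperplane that contains no root. *)
Definition positive_system (R : realType) (d : nat)
    (Phi P : {fset 'cV[R]_d}) : Prop :=
  exists l : 'cV[R]_d,
    (forall a, a \in Phi -> dot l a != 0) /\
    P = [fset a in Phi | 0 < dot l a].

(* The positive roots that are not nonnegative combinations of the other
   positive roots, i.e. those that span the extreme rays of the cone of P. *)
Definition simple_root (R : realType) (d : nat) (P : {fset 'cV[R]_d})
    (a : 'cV[R]_d) : Prop :=
  a \in P /\
  ~ exists c : 'cV[R]_d -> R,
      (forall b, 0 <= c b) /\ a = \sum_(b <- P `\ a) c b *: b.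

Definition simple_reflection (R : realType) (d : nat) (P : {fset 'cV[R]_d})
    (s : 'M[R]_d) : Prop :=
  exists2 a, simple_root P a & s = refl a.

Inductive weyl (R : realType) (d : nat) (Phi : {fset 'cV[R]_d}) :
    'M[R]_d -> Prop :=
| weyl_refl a : a \in Phi -> weyl Phi (refl a)
| weyl_one : weyl Phi 1%:M
| weyl_mul u v : weyl Phi u -> weyl Phi v -> weyl Phi (u *m v)
| weyl_inv u : weyl Phi u -> weyl Phi (invmx u).

(* Negative roots are allowed: inv_set Phi P 1%:M is the set of all negative
   roots. *)
Definition inv_set (R : realType) (d : nat) (Phi P : {fset 'cV[R]_d})
    (w : 'M[R]_d) : {fset 'cV[R]_d} :=
  [fset a in Phi | invmx w *m a \in Phi `\` P].

Definition longest (R : realType) (d : nat) (Phi P : {fset 'cV[R]_d})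
    (w0 : 'M[R]_d) : Prop :=
  weyl Phi w0 /\ inv_set Phi P w0 = P.

Definition root_triple (R : realType) (d : nat) (Phi : {fset 'cV[R]_d})
    (a b c : 'cV[R]_d) : Prop :=
  [/\ [/\ a \in Phi, b \in Phi & c \in Phi],
      [/\ a <> b, a <> c & b <> c]
    & exists x y z : R,
        [/\ 0 < x, 0 < y & 0 < z] /\ x *: a + y *: b + z *: c = 0].

Definition nonempty_subset (R : realType) (d : nat) (Phi : {fset 'cV[R]_d})
    (D : {fset 'M[R]_d}) : Prop :=
  D != fset0 /\ forall w, w \in D -> weyl Phi w.

Definition condorcet (R : realType) (d : nat) (Phi P : {fset 'cV[R]_d})
    (D : {fset 'M[R]_d}) : Prop :=
  nonempty_subset Phi D /\
  ~ exists u v w, exists a b c,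
      [/\ [/\ u \in D, v \in D & w \in D],
          [/\ u <> v, u <> w & v <> w],
          root_triple Phi a b c
        & [/\ a \in inv_set Phi P u /\ b \in inv_set Phi P u,
              a \in inv_set Phi P v /\ c \in inv_set Phi P v
            & b \in inv_set Phi P w /\ c \in inv_set Phi P w]].

Definition maximal_condorcet (R : realType) (d : nat)
    (Phi P : {fset 'cV[R]_d}) (D : {fset 'M[R]_d}) : Prop :=
  condorcet Phi P D /\
  ~ exists D' : {fset 'M[R]_d}, condorcet Phi P D' /\ D `<` D'.

Definition voting_profile (R : realType) (d : nat) (D : {fset 'M[R]_d})
    (f : D -> nat) : Prop :=
  exists w, f w <> 0%N.

Definition votes (R : realType) (d : nat) (Phi P : {fset 'cV[R]_d})
    (D : {fset 'M[R]_d}) (f : D -> nat) (a : 'cV[R]_d) : nat :=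
  (\sum_(w : D | a \in inv_set Phi P (val w)) f w)%N.

Definition total_votes (R : realType) (d : nat) (D : {fset 'M[R]_d})
    (f : D -> nat) : nat :=
  (\sum_(w : D) f w)%N.

Definition majority_set (R : realType) (d : nat) (Phi P : {fset 'cV[R]_d})
    (D : {fset 'M[R]_d}) (f : D -> nat) : {fset 'cV[R]_d} :=
  [fset a in Phi | (total_votes f)%:R / 2 <= (votes Phi P f a)%:R :> rat].

Definition no_tie (R : realType) (d : nat) (Phi P : {fset 'cV[R]_d})
    (D : {fset 'M[R]_d}) (f : D -> nat) : Prop :=
  forall a, a \in Phi ->
    (votes Phi P f a)%:R <> (total_votes f)%:R / 2 :> rat.

Definition voting_result (R : realType) (d : nat) (Phi P : {fset 'cV[R]_d})
    (D : {fset 'M[R]_d}) (f : D -> nat) (w : 'M[R]_d) : Prop :=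
  weyl Phi w /\ inv_set Phi P w `<=` majority_set Phi P f.

Definition nu (R : realType) (d : nat) (Phi P : {fset 'cV[R]_d})
    (D : {fset 'M[R]_d}) (w : 'M[R]_d) : Prop :=
  exists f : D -> nat,
    [/\ voting_profile f, no_tie Phi P f & voting_result Phi P f w].

Definition closed_condorcet (R : realType) (d : nat)
    (Phi P : {fset 'cV[R]_d}) (D : {fset 'M[R]_d}) : Prop :=
  condorcet Phi P D /\ forall w, nu Phi P D w <-> w \in D.

Definition connected_domain (R : realType) (d : nat)
    (Phi P : {fset 'cV[R]_d}) (D : {fset 'M[R]_d}) : Prop :=
  forall u v, u \in D -> v \in D ->
    exists p : seq 'M[R]_d,
      [/\ {subset p <= D},
          path (fun x y => #|` inv_set Phi P y `\` inv_set Phi P x| == 1%N) u p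
        & last u p = v].

Definition maximal_width (R : realType) (d : nat) (w0 : 'M[R]_d)
    (D : {fset 'M[R]_d}) : Prop :=
  exists2 v, v \in D & v *m w0 \in D.

Definition word_prod (R : realType) (d : nat) (i : seq 'M[R]_d) : 'M[R]_d :=
  \big[mulmx/1%:M]_(s <- i) s.

Definition word_for (R : realType) (d : nat) (P : {fset 'cV[R]_d})
    (w : 'M[R]_d) (i : seq 'M[R]_d) : Prop :=
  (forall s, s \in i -> simple_reflection P s) /\ w = word_prod i.

Definition reduced_word (R : realType) (d : nat) (P : {fset 'cV[R]_d})
    (w : 'M[R]_d) (i : seq 'M[R]_d) : Prop :=
  word_for P w i /\ forall j, word_for P w j -> (size i <= size j)%N.

Inductive commutation_class (R : realType) (d : nat) (i : seq 'M[R]_d) :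
    seq 'M[R]_d -> Prop :=
| commutation_refl : commutation_class i i
| commutation_step p s t q :
    commutation_class i (p ++ [:: s, t & q]) -> s *m t = t *m s ->
    commutation_class i (p ++ [:: t, s & q]).

Definition tiling_type (R : realType) (d : nat) (Phi P : {fset 'cV[R]_d})
    (w0 : 'M[R]_d) (D : {fset 'M[R]_d}) : Prop :=
  nonempty_subset Phi D /\
  exists2 i, reduced_word P w0 i
    & forall w, w \in D <->
        exists j l, [/\ commutation_class i j, (l <= size i)%N
                      & w = word_prod (take l j)].

(* Main.v *)
Require Import Defs.
From mathcomp Require Import all_boot all_order all_algebra finmap reals.
From mathcomp Require Import boolp lra.

Set Implicit Arguments.
Unset Strict Implicit.
Unset Printing Implicit Defensive.

Import Order.TTheory GRing.Theory Num.Theory.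

Local Open Scope fset_scope.
Local Open Scope ring_scope.

(** The inversion set of w consists of the roots that w^-1 makes negative, so
    it is the negative side of a hyperplane and never contains the three roots
    of a vanishing positive combination (inv_set_pointed). Together with the
    Condorcet condition, this lets three members of a domain that show the
    forbidden pattern be recognised without checking that they are distinct
    (condorcet_triple). An inversion set determines its element
    (inv_set_inj), and the inversions of a product of simple reflections
    appear one by one along the word (inv_word_split).

    The heart of the proof is mem_prefix: if a Condorcet domain E contains all
    prefixes of the words in the commutation class of a reduced word i for w0,
    then every w in E is such a prefix. Indeed, suppose that in a word of the
    class a letter that w does not invert is followed by one that it inverts.
    If the two letters did not commute, w and the prefixes before and after
    them would show the forbidden pattern on the two roots that they add and a
    third root of their plane (inverted_orthogonal). So they can be exchanged,
    and a bubble sort inside the class moves the inversions of w to the front.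
    The prefix that they form has the inversions of w, hence equals w.

    A domain of tiling type is connected, because prefixes of a word differ by
    one inversion at a time, and it is maximal by mem_prefix applied to any
    larger Condorcet domain.

    Conversely, let D be closed, maximal and connected with 1 and w0 in D. The
    path from 1 to w0 in D need not be monotone, but closedness repairs this:
    the majority of w0, w and x is the union of the positive inversions of w
    and x, so the running unions along the path lie in D (monotone_path), and
    they spell a reduced word for w0 with all prefixes in D. Exchanging two
    commuting letters keeps the prefixes in D by maximality: on each root
    triple the new prefix looks like one of its neighbours
    (maximal_exchange). Hence D contains the prefixes of the whole commutation
    class, and by mem_prefix nothing else. *)

(** * Reflections *)

Section Reflections.
Variables (R : realType) (d : nat).
Implicit Types (x y z a b : 'cV[R]_d) (c : R) (u : 'M[R]_d).

Lemma dotE x y : dot x y = (x^T *m y) 0 0.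
Proof. by rewrite mxE; apply: eq_bigr => i _; rewrite mxE. Qed.

Lemma dotC x y : dot x y = dot y x.
Proof. by apply: eq_bigr => i _; rewrite mulrC. Qed.

Lemma dotDr x y z : dot x (y + z) = dot x y + dot x z.
Proof. by rewrite !dotE mulmxDr mxE. Qed.

Lemma dotZr c x y : dot x (c *: y) = c * dot x y.
Proof. by rewrite !dotE -scalemxAr mxE. Qed.

Lemma dotNr x y : dot x (- y) = - dot x y.
Proof. by rewrite -scaleN1r dotZr mulN1r. Qed.

Lemma dot0r x : dot x 0 = 0.
Proof. by rewrite -(scale0r 0) dotZr mul0r. Qed.

Lemma dotDl x y z : dot (y + z) x = dot y x + dot z x.
Proof. by rewrite ![dot _ x]dotC dotDr. Qed.

Lemma dotZl c x y : dot (c *: y) x = c * dot y x.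
Proof. by rewrite ![dot _ x]dotC dotZr. Qed.

Lemma dotNl x y : dot (- y) x = - dot y x.
Proof. by rewrite ![dot _ x]dotC dotNr. Qed.

Definition dot_linear := (dotDl, dotDr, dotNl, dotNr, dotZl, dotZr).

Lemma dot_gt0 x : x != 0 -> 0 < dot x x.
Proof.
move=> x0; rewrite lt_def sumr_ge0 ?andbT => [|i _]; last exact: sqr_ge0.
apply: contra x0; rewrite psumr_eq0 => [/allP h|i _]; last exact: sqr_ge0.
apply/eqP/colP => i; rewrite mxE; apply/eqP.
by have := h i (mem_index_enum _); rewrite mulf_eq0 orbb.
Qed.

Lemma dot_orthogonal u x y : u^T *m u = 1%:M -> dot (u *m x) (u *m y) = dot x y.
Proof. by move=> uu; rewrite !dotE trmx_mul -mulmxA (mulmxA _ u) uu mul1mx. Qed.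

Lemma reflE a x : refl a *m x = x - (2 * dot a x / dot a a) *: a.
Proof.
rewrite mulmxBl mul1mx -scalemxAl -mulmxA [a^T *m x]mx11_scalar -dotE.
by rewrite mul_mx_scalar scalerA mulrAC.
Qed.

Lemma eq_mulmx_col u v : (forall x, u *m x = v *m x) -> u = v.
Proof.
move=> uv; apply/matrixP => i j.
by have /colP/(_ i) := uv (delta_mx j 0); rewrite -!colE !mxE.
Qed.

Lemma reflN a : refl (- a) = refl a.
Proof.
apply: eq_mulmx_col => x; rewrite !reflE !dot_linear opprK.
by rewrite mulrN mulNr scalerN scaleNr opprK.
Qed.

Lemma refl_self a : a != 0 -> refl a *m a = - a.
Proof.
move=> /dot_gt0/lt0r_neq0 a0.
by rewrite reflE mulfK // scaler_nat mulr2n opprD addNKr.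
Qed.

Lemma reflK a x : a != 0 -> refl a *m (refl a *m x) = x.
Proof.
move=> a0; rewrite [refl a *m x]reflE mulmxBr -scalemxAr refl_self // reflE.
by rewrite scalerN opprK subrK.
Qed.

Lemma refl_mul_self a : a != 0 -> refl a *m refl a = 1%:M.
Proof.
by move=> a0; apply: eq_mulmx_col => x; rewrite -mulmxA reflK // mul1mx.
Qed.

Lemma trmx_refl a : (refl a)^T = refl a.
Proof. by rewrite /refl linearB linearZ /= trmx_mul trmxK trmx1. Qed.

Lemma refl_conj u a : u^T *m u = 1%:M -> refl (u *m a) *m u = u *m refl a.
Proof.
move=> uu; apply: eq_mulmx_col => x; rewrite -!mulmxA !reflE mulmxBr.
by rewrite !dot_orthogonal // scalemxAr.
Qed.

Lemma refl_commute a b : dot a b = 0 -> refl a *m refl b = refl b *m refl a.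
Proof.
move=> ab; have ba : dot b a = 0 by rewrite dotC.
apply: eq_mulmx_col => x; rewrite -!mulmxA !reflE !dot_linear ab ba.
by rewrite !mulr0 !subr0 addrAC.
Qed.

Lemma refl_fix a b : dot a b = 0 -> refl a *m b = b.
Proof. by move=> ab; rewrite reflE ab mulr0 mul0r scale0r subr0. Qed.

End Reflections.

(** * Cones of vectors on the positive side of a hyperplane *)

Section Cone.
Variables (R : realType) (d : nat).
Implicit Types (S : {fset 'cV[R]_d}) (v x y : 'cV[R]_d) (c : R).

Inductive cone S : 'cV[R]_d -> Prop :=
| cone0 : cone S 0
| cone_cons x v c : x \in S -> 0 <= c -> cone S v -> cone S (c *: x + v).

Lemma coneD S v y : cone S v -> cone S y -> cone S (v + y).
Proof.
move=> Sv Sy; elim: Sv => [|x w c Sx c0 _ ih]; first by rewrite add0r.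
by rewrite -addrA; apply: cone_cons.
Qed.

Lemma coneZ S v c : 0 <= c -> cone S v -> cone S (c *: v).
Proof.
move=> c0; elim=> [|x w e Sx e0 _ ih]; first by rewrite scaler0; apply: cone0.
by rewrite scalerDr scalerA; apply: cone_cons => //; apply: mulr_ge0.
Qed.

Lemma cone_mem S x : x \in S -> cone S x.
Proof.
move=> Sx; rewrite -[x]addr0 -[x]scale1r; apply: cone_cons => //.
exact: cone0.
Qed.

Lemma cone_sub S S' v : (forall x, x \in S -> cone S' x) -> cone S v -> cone S' v.
Proof.
move=> SS'; elim=> [|x w c Sx c0 _ ih]; first exact: cone0.
by apply: coneD => //; apply/coneZ/SS'.
Qed.

Lemma coneP S v : cone S v <->
  exists c : 'cV[R]_d -> R, (forall x, 0 <= c x) /\ v = \sum_(x <- S) c x *: x.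
Proof.
split=> [|[c [c0 ->]]].
  elim=> [|x w e Sx e0 _ [c [c0 ->]]].
    by exists (fun=> 0); split=> //; rewrite big1 // => x; rewrite scale0r.
  exists (fun y => c y + (if y == x then e else 0)); split=> [y|].
    by case: ifP => _; rewrite addr_ge0.
  under [RHS]eq_bigr do rewrite scalerDl.
  rewrite big_split /= addrC; congr (_ + _).
  rewrite (bigD1_seq x) ?fset_uniq //= eqxx big1 ?addr0 // => y /negPf ->.
  by rewrite scale0r.
rewrite big_seq; apply: big_ind; [exact: cone0|exact: coneD|move=> x Sx].
by apply: coneZ => //; apply: cone_mem.
Qed.

(** If every generator had a nonpositive product with y, then so would all of
    their combinations. *)
Lemma cone_dot_gt0 S v y : cone S v -> 0 < dot y v ->
  exists2 x, x \in S & 0 < dot y x.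
Proof.
elim=> [|x w c Sx c0 _ ih]; first by rewrite dot0r ltxx.
rewrite dotDr dotZr; case: (ltP 0 (dot y x)) => [yx _|yx]; first by exists x.
by move=> h; apply: ih; apply: lt_le_trans h _; rewrite gerDr mulr_ge0_le0.
Qed.

Variable l : 'cV[R]_d.

Lemma cone_ge0 S v : (forall x, x \in S -> 0 < dot l x) -> cone S v -> 0 <= dot l v.
Proof.
move=> lS; elim=> [|x w c /lS lx c0 _ ih]; first by rewrite dot0r.
by rewrite dotDr dotZr addr_ge0 // mulr_ge0 // ltW.
Qed.

Lemma cone_eq0 S v : (forall x, x \in S -> 0 < dot l x) -> cone S v ->
  dot l v = 0 -> v = 0.
Proof.
move=> lS; elim=> [//|x w c Sx c0 Sw ih] /eqP; rewrite dotDr dotZr.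
have lx := lS _ Sx; rewrite paddr_eq0 ?(cone_ge0 lS Sw) ?mulr_ge0 ?(ltW lx) //.
rewrite mulf_eq0 (gt_eqF lx) orbF => /andP[/eqP -> /eqP/ih ->].
by rewrite scale0r addr0.
Qed.

Lemma cone_split S a v : cone S v ->
  exists c z, [/\ 0 <= c, cone (S `\ a) z & v = c *: a + z].
Proof.
elim=> [|x w e Sx e0 _ [c [z [c0 Sz ->]]]].
  by exists 0, 0; split=> //; [exact: cone0|rewrite scale0r addr0].
have [->|xa] := eqVneq x a.
  by exists (e + c), z; split=> //; [rewrite addr_ge0|rewrite scalerDl addrA].
exists c, (e *: x + z); split; [done| |by rewrite addrCA].
by apply: cone_cons => //; rewrite in_fsetD1 xa.
Qed.

(** Write a as a combination of the other members of P, expand these over S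
    and collect the multiples of a: the result is a = c a + z with z in the
    cone of S without a. Here z is nonzero, since otherwise the members of P
    used for a would be multiples of a. So c < 1 by taking products with l,
    and a is a multiple of z. *)
Lemma cone_drop (S P : {fset 'cV[R]_d}) a :
  (forall x, x \in P -> 0 < dot l x) -> S `<=` P -> a \in P ->
  (forall x, x \in P -> cone S x) ->
  (forall x c, x \in P -> x = c *: a -> x = a) ->
  cone (P `\ a) a -> cone (S `\ a) a.
Proof.
move=> lP /fsubsetP SP Pa PS Pray Pa_a.
have lS x : x \in S `\ a -> 0 < dot l x.
  by rewrite in_fsetD1 => /andP[_ /SP/lP].
have decomp v : cone (P `\ a) v -> exists c z,
    [/\ 0 <= c, cone (S `\ a) z, dot l z = 0 -> v = 0 & v = c *: a + z].
  elim=> [|x w e].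
    by exists 0, 0; split=> //; [exact: cone0|rewrite scale0r addr0].
  rewrite in_fsetD1 => /andP[xa Px] e0 _ [c [z [c0 Sz z0 eqw]]].
  have [y [t [y0 St eqx]]] := cone_split a (PS x Px).
  exists (e * y + c), (e *: t + z); split.
  - by rewrite addr_ge0 ?mulr_ge0.
  - by apply: coneD => //; apply: coneZ.
  - have [t0|t_gt0] : dot l t = 0 \/ 0 < dot l t.
      by have := cone_ge0 lS St; rewrite le_eqVlt => /orP[/eqP|]; [left|right].
      have t00 := cone_eq0 lS St t0.
      by move: xa; rewrite (Pray x y) ?eqxx // eqx t00 addr0.
    rewrite dotDr dotZr => /eqP.
    rewrite paddr_eq0 ?(cone_ge0 lS Sz) ?mulr_ge0 ?(ltW t_gt0) //.
    rewrite mulf_eq0 (gt_eqF t_gt0) orbF => /andP[/eqP -> /eqP/z0 w0].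
    by rewrite scale0r add0r.
  - rewrite eqw {1}eqx scalerDr scalerA scalerDl -!addrA; congr (_ + _).
    by rewrite addrCA.
have [c [z [c0 Sz z0 eqa]]] := decomp _ Pa_a.
have z_gt0 : 0 < dot l z.
  have := cone_ge0 lS Sz; rewrite le_eqVlt => /orP[/eqP/esym/z0 a0|//].
  by have := lP _ Pa; rewrite a0 dot0r ltxx.
have c1 : 0 < 1 - c.
  have h : dot l a = c * dot l a + dot l z by rewrite {1}eqa dotDr dotZr.
  have := lP _ Pa; nra.
have eqz : a = (1 - c)^-1 *: z.
  apply: (scalerI (lt0r_neq0 c1)); rewrite scalerA mulfV ?lt0r_neq0 // scale1r.
  by rewrite scalerBl scale1r {1}eqa addrAC subrr add0r.
by rewrite [X in cone _ X]eqz; apply: coneZ => //; rewrite invr_ge0 ltW.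
Qed.

End Cone.

(** * Words in reflections *)

Section Words.
Variables (R : realType) (d : nat).
Implicit Types (A B : seq 'cV[R]_d) (a : 'cV[R]_d).

(** Words are handled as sequences of roots: a simple reflection alone does
    not say which of its two roots is meant. *)
Definition rprod A : 'M[R]_d := word_prod [seq refl a | a <- A].

Lemma rprod_nil : rprod [::] = 1%:M.
Proof. by rewrite /rprod /word_prod big_nil. Qed.

Lemma rprod_cons a A : rprod (a :: A) = refl a *m rprod A.
Proof. by rewrite /rprod /word_prod big_cons. Qed.

Lemma rprod_cat A B : rprod (A ++ B) = rprod A *m rprod B.
Proof.
by elim: A => [|a A ih]; rewrite ?rprod_nil ?mul1mx //= !rprod_cons ih mulmxA.
Qed.

Lemma rprod1 a : rprod [:: a] = refl a.
Proof. by rewrite rprod_cons rprod_nil mulmx1. Qed.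

Lemma rprod_rcons A a : rprod (rcons A a) = rprod A *m refl a.
Proof. by rewrite -cats1 rprod_cat rprod1. Qed.

Lemma trmx_rprod A : (rprod A)^T = rprod (rev A).
Proof.
elim: A => [|a A ih]; first by rewrite rprod_nil trmx1.
by rewrite rev_cons rprod_rcons rprod_cons trmx_mul ih trmx_refl.
Qed.

End Words.

(** * Simple roots and the Weyl group *)

Section Weyl.
Variables (R : realType) (d : nat) (Phi P : {fset 'cV[R]_d}) (l : 'cV[R]_d).
Hypothesis rootsPhi : root_system Phi.
Hypothesis l_neq0 : forall a, a \in Phi -> dot l a != 0.
Hypothesis PE : P = [fset a in Phi | 0 < dot l a].
Implicit Types (a b x y : 'cV[R]_d) (u v w : 'M[R]_d) (A B : seq 'cV[R]_d).
Local Notation I := (inv_set Phi P).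
Local Notation W := (weyl Phi).

Lemma root_neq0 a : a \in Phi -> a != 0.
Proof. by case: rootsPhi => h _ _ ha; apply: contraNneq h => <-. Qed.

Lemma rootN a : a \in Phi -> - a \in Phi.
Proof.
by case: rootsPhi => _ h _ ha; case: (h a ha (- a)) => _ []; first by right.
Qed.

Lemma root_line a b c : a \in Phi -> b \in Phi -> b = c *: a -> b = a \/ b = - a.
Proof.
case: rootsPhi => _ h _ ha hb eb; case: (h a ha b) => h1 _; apply: h1.
by split=> //; exists c.
Qed.

Lemma refl_root a b : a \in Phi -> b \in Phi -> refl a *m b \in Phi.
Proof.
by case: rootsPhi => _ _ h ha hb; rewrite -(h a ha); apply: in_imfset.
Qed.

Lemma mem_pos a : (a \in P) = (a \in Phi) && (0 < dot l a).
Proof. by rewrite PE !inE. Qed.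

Lemma pos_root a : a \in P -> a \in Phi.
Proof. by rewrite mem_pos => /andP[]. Qed.

Lemma pos_gt0 a : a \in P -> 0 < dot l a.
Proof. by rewrite mem_pos => /andP[]. Qed.

Lemma posN a : a \in Phi -> (- a \in P) = (a \notin P).
Proof.
move=> ha; rewrite !mem_pos ha rootN // dotNr oppr_gt0 -leNgt le_eqVlt.
by rewrite (negPf (l_neq0 ha)).
Qed.

Lemma pos_line a b c : a \in P -> b \in P -> b = c *: a -> b = a.
Proof.
move=> ha hb eb; case: (root_line (pos_root ha) (pos_root hb) eb) => // eba.
by move: hb; rewrite eba posN ?pos_root // ha.
Qed.

Lemma weyl_orth u : W u -> u^T *m u = 1%:M.
Proof.
elim=> [a ha| |v w _ hv _ hw|v _ hv].
- by rewrite trmx_refl refl_mul_self ?root_neq0.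
- by rewrite trmx1 mul1mx.
- by rewrite trmx_mul -mulmxA (mulmxA _ v) hv mul1mx.
have [_ vU] := mulmx1_unit hv.
have -> : invmx v = v^T by rewrite -[RHS]mulmx1 -(mulmxV vU) mulmxA hv mul1mx.
by rewrite trmxK; apply: mulmx1C.
Qed.

Lemma weyl_orthC u : W u -> u *m u^T = 1%:M.
Proof. by move=> /weyl_orth/mulmx1C. Qed.

Lemma weyl_invmx u : W u -> invmx u = u^T.
Proof.
move=> hu; have [_ uU] := mulmx1_unit (weyl_orth hu).
by rewrite -[RHS]mulmx1 -(mulmxV uU) mulmxA weyl_orth // mul1mx.
Qed.

Lemma weyl_tr u : W u -> W u^T.
Proof. by move=> hu; rewrite -weyl_invmx //; apply: weyl_inv. Qed.

Lemma weyl_root u a : W u -> a \in Phi -> u *m a \in Phi.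
Proof.
move=> hu; suff [] : (forall b, b \in Phi -> u *m b \in Phi) /\
  (forall b, b \in Phi -> u^T *m b \in Phi) by move=> h _ /h.
elim: hu => [b hb| |v w _ [hv hv'] _ [hw hw']|v Wv [hv hv']].
- by rewrite trmx_refl; split=> c; apply: refl_root.
- by rewrite trmx1; split=> c; rewrite mul1mx.
- by rewrite trmx_mul; split=> c hc; rewrite -mulmxA; auto.
by rewrite weyl_invmx // trmxK.
Qed.

Lemma weylK u x : W u -> u^T *m (u *m x) = x.
Proof. by move=> hu; rewrite mulmxA weyl_orth // mul1mx. Qed.

Lemma weylKV u x : W u -> u *m (u^T *m x) = x.
Proof. by move=> hu; rewrite mulmxA weyl_orthC // mul1mx. Qed.

(** ** Inversion sets *)

Lemma mem_inv u x : W u -> x \in Phi -> (x \in I u) = (u^T *m x \notin P).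
Proof.
move=> hu hx; rewrite !inE /= hx weyl_invmx //= weyl_root ?andbT //.
exact: weyl_tr.
Qed.

Lemma inv_root u x : x \in I u -> x \in Phi.
Proof. by rewrite !inE => /andP[]. Qed.

Lemma mem_invN u x : W u -> x \in Phi -> (- x \in I u) = (x \notin I u).
Proof.
move=> hu hx; rewrite !mem_inv ?rootN // mulmxN posN //.
by apply: weyl_root => //; apply: weyl_tr.
Qed.

Lemma mem_inv1 x : x \in Phi -> (x \in I 1%:M) = (x \notin P).
Proof. by move=> hx; rewrite mem_inv ?trmx1 ?mul1mx //; apply: weyl_one. Qed.

Lemma mem_inv_image u x : W u -> x \in Phi -> (u *m x \in I u) = (x \notin P).
Proof. by move=> hu hx; rewrite mem_inv ?weylK ?weyl_root. Qed.

(** Pulled back by the Weyl group element, the three roots lie strictly on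
    one side of the hyperplane orthogonal to l, so no positive combination of
    them vanishes. *)
Lemma inv_set_pointed u a b c (r s t : R) : W u ->
  0 < r -> 0 < s -> 0 < t -> r *: a + s *: b + t *: c = 0 ->
  a \in I u -> b \in I u -> c \in I u -> False.
Proof.
move=> hu r0 s0 t0 abc ha hb hc.
have neg x : x \in I u -> dot l (u^T *m x) < 0.
  move=> hx; have Px := inv_root hx; move: hx; rewrite mem_inv // -posN.
    by move/pos_gt0; rewrite dotNr oppr_gt0.
  by apply: weyl_root => //; apply: weyl_tr.
have: dot l (u^T *m (r *: a + s *: b + t *: c)) = 0 by rewrite abc mulmx0 dot0r.
rewrite !mulmxDr -!scalemxAr !dotDr !dotZr.
have := neg _ ha; have := neg _ hb; have := neg _ hc; nra.
Qed.

(** ** Simple roots *)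

Lemma simple_rootP a : simple_root P a <-> a \in P /\ ~ cone (P `\ a) a.
Proof. by split=> -[ha h]; split=> // hc; apply: h; apply/coneP. Qed.

Lemma simple_pos a : simple_root P a -> a \in P.
Proof. by case. Qed.

Lemma simple_phi a : simple_root P a -> a \in Phi.
Proof. by move=> /simple_pos/pos_root. Qed.

Lemma simple_weyl a : simple_root P a -> W (refl a).
Proof. by move=> /simple_phi; apply: weyl_refl. Qed.

(** If y = - refl a x were positive, then x + y would be a positive multiple
    of a, and a would not be simple. *)
Lemma simple_refl_pos a x :
  simple_root P a -> x \in P -> x != a -> refl a *m x \in P.
Proof.
move=> sa hx xa; have ha := simple_phi sa; apply/negPn/negP.
rewrite -posN; last exact/refl_root/pos_root.
set y := - _ => hy; have /simple_rootP[Pa na] := sa; apply: na.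
have ya : y != a.
  apply: contra xa => /eqP ya; have /eqP := reflK x (root_neq0 ha).
  by rewrite -[refl a *m x]opprK -/y ya mulmxN refl_self ?root_neq0 // opprK eq_sym.
set k := 2 * dot a x / dot a a.
have exy : x + y = k *: a by rewrite /y reflE opprB addrC subrK.
have k0 : 0 < k.
  have := congr1 (dot l) exy; rewrite dotDr dotZr.
  have := pos_gt0 Pa; have := pos_gt0 hx; have := pos_gt0 hy; nra.
have ea : a = k^-1 *: (x + y) by rewrite exy scalerA mulVf ?scale1r ?lt0r_neq0.
rewrite [X in cone _ X]ea; apply: coneZ; first by rewrite invr_ge0 ltW.
by apply: coneD; apply: cone_mem; rewrite in_fsetD1 ?xa ?ya.
Qed.

(** Otherwise b is refl a b, a positive root, plus a positive multiple of a. *)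
Lemma simple_dot_le0 a b :
  simple_root P a -> simple_root P b -> a != b -> dot a b <= 0.
Proof.
move=> sa sb ab; rewrite leNgt; apply/negP => ab0.
have ha := simple_pos sa; have /simple_rootP[hb nb] := sb; apply: nb.
set k := 2 * dot a b / dot a a.
have k0 : 0 < k by rewrite divr_gt0 ?mulr_gt0 ?dot_gt0 ?root_neq0 ?pos_root.
have eb : b = refl a *m b + k *: a by rewrite reflE subrK.
rewrite [X in cone _ X]eb; apply: coneD.
  apply: cone_mem; rewrite in_fsetD1 simple_refl_pos 1?eq_sym ?andbT //.
  apply: contraTneq k0 => e; move: eb => /eqP.
  rewrite -e eq_sym -subr_eq0 addrAC subrr add0r scaler_eq0.
  by rewrite (negPf (root_neq0 (pos_root ha))) orbF => /eqP ->; rewrite ltxx.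
by apply: coneZ; rewrite ?ltW //; apply: cone_mem; rewrite in_fsetD1 ab.
Qed.

(** In a smallest set of positive roots whose cone contains P every member is
    simple, since cone_drop removes the others. *)
Lemma cone_simple : exists2 S : {fset 'cV[R]_d},
  (forall a, a \in S -> simple_root P a) & (forall x, x \in P -> cone S x).
Proof.
suff h n (S : {fset 'cV[R]_d}) : (#|` S| < n)%N -> S `<=` P ->
  (forall x, x \in P -> cone S x) -> exists2 S : {fset 'cV[R]_d},
  (forall a, a \in S -> simple_root P a) & (forall x, x \in P -> cone S x).
  by apply: (h _ P (ltnSn _)) => // x; apply: cone_mem.
elim: n S => // n ih S; rewrite ltnS => Sn SP PS.
have [allS|/existsNP[a /not_implyP[Sa na]]] :=
  pselect (forall a, a \in S -> simple_root P a); first by exists S.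
have Pa : a \in P by apply: (fsubsetP SP).
apply: (ih (S `\ a)).
- by rewrite (leq_trans _ Sn) // [X in (_ < X)%N](cardfsD1 a) Sa.
- by apply: fsubset_trans SP; apply: fsubD1set.
move=> x /PS; apply: cone_sub => y Sy.
have [->|ya] := eqVneq y a; last by apply: cone_mem; rewrite in_fsetD1 ya.
apply: (@cone_drop _ _ l S P) => //; first exact: pos_gt0.
  by move=> z c Pz; apply: pos_line.
by apply: contrapT => nc; apply: na; apply/simple_rootP.
Qed.

Lemma simple_dot_gt0 x : x \in P -> exists2 a, simple_root P a & 0 < dot x a.
Proof.
move=> hx; have [S sS PS] := cone_simple.
have [a Sa xa] := cone_dot_gt0 (PS x hx) (dot_gt0 (root_neq0 (pos_root hx))).
by exists a; first exact: sS.
Qed.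

(** A positive root that is not simple has a positive product with some
    simple root a, and reflecting it in a subtracts a positive multiple of a. *)
Lemma nonsimple_split x : x \in P -> ~ simple_root P x -> exists a c,
  [/\ simple_root P a, 0 < c, refl a *m x \in P & x = refl a *m x + c *: a].
Proof.
move=> hx nx; have [a sa xa] := simple_dot_gt0 hx.
exists a, (2 * dot a x / dot a a); split; first exact: sa.
- have aa := dot_gt0 (root_neq0 (simple_phi sa)).
  by apply: divr_gt0 aa; rewrite dotC; apply: mulr_gt0 xa; rewrite ltr0n.
- by apply: (simple_refl_pos sa hx); apply: contra_notN nx => /eqP ->.
by rewrite reflE subrK.
Qed.

Definition simple_word A := forall a, a \in A -> simple_root P a.

Lemma simple_word_cons a A :
  simple_word (a :: A) <-> simple_root P a /\ simple_word A.
Proof.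
split=> [h|[sa sA] b]; last by rewrite in_cons => /predU1P[->//|/sA].
by split=> [|b hb]; apply: h; rewrite in_cons ?eqxx ?hb ?orbT.
Qed.

Lemma simple_word_cat A B : simple_word (A ++ B) <-> simple_word A /\ simple_word B.
Proof.
split=> [h|[sA sB] b]; last by rewrite mem_cat => /orP[/sA|/sB].
by split=> b hb; apply: h; rewrite mem_cat hb ?orbT.
Qed.

Lemma weyl_rprod A : simple_word A -> W (rprod A).
Proof.
elim: A => [|a A ih]; first by rewrite rprod_nil => _; apply: weyl_one.
move=> /simple_word_cons[sa sA]; rewrite rprod_cons.
by apply: weyl_mul; [apply: simple_weyl|apply: ih].
Qed.

(** Conjugating by a simple reflection as in nonsimple_split lowers the root
    with respect to l, until it is simple. *)
Lemma refl_pos_word x : x \in P -> exists2 A, simple_word A & refl x = rprod A.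
Proof.
move: {2}_.+1 (ltnSn #|` [fset y in P | dot l y < dot l x]|) => n.
elim: n x => // n ih x; rewrite ltnS => xn hx.
have [sx|nx] := pselect (simple_root P x).
  by exists [:: x]; rewrite ?rprod1 // => a; rewrite inE => /eqP ->.
have [a [c [sa c0 ax xE]]] := nonsimple_split hx nx.
have lt_ax : dot l (refl a *m x) < dot l x.
  rewrite [X in _ < dot l X]xE dotDr dotZr ltrDl.
  exact: mulr_gt0 c0 (pos_gt0 (simple_pos sa)).
have [|//|A sA eA] := ih (refl a *m x).
  apply: leq_trans xn; apply: fproper_ltn_card; rewrite fproperE.
  apply/andP; split.
    by apply/fsubsetP => y; rewrite !inE /= => /andP[-> /lt_trans->].
  by apply/fsubsetPn; exists (refl a *m x); rewrite !inE /= ax ?ltxx.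
exists (a :: rcons A a).
  apply/simple_word_cons; split; first exact: sa.
  rewrite -cats1; apply/simple_word_cat; split; first exact: sA.
  by move=> b; rewrite inE => /eqP ->.
have ra : refl a *m refl a = 1%:M by apply/refl_mul_self/root_neq0/simple_phi.
rewrite rprod_cons rprod_rcons -eA refl_conj; last by rewrite trmx_refl.
by rewrite mulmxA ra mul1mx.
Qed.

Lemma weyl_word w : W w -> exists2 A, simple_word A & w = rprod A.
Proof.
elim=> [a ha| |u v _ [A sA ->] _ [B sB ->]|u Wu [A sA uA]].
- have [Pa|nPa] := boolP (a \in P); first exact: refl_pos_word.
  by rewrite -reflN; apply: refl_pos_word; rewrite posN.
- by exists [::]; rewrite ?rprod_nil.
- by exists (A ++ B); rewrite ?rprod_cat //; apply/simple_word_cat.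
exists (rev A) => [a|]; first by rewrite mem_rev => /sA.
by rewrite weyl_invmx // uA trmx_rprod.
Qed.

(** Reading the word from the right, the image of a becomes negative at some
    letter b; just before, it is b itself, and the letter b may be moved
    through the rest of the word, where it turns into a and cancels. *)
Lemma exchange A a : simple_word A -> simple_root P a -> rprod A *m a \notin P ->
  exists B, [/\ simple_word B, size A = (size B).+1 & rprod B = rprod A *m refl a].
Proof.
move=> + sa; elim: A => [|b A ih]; first by rewrite rprod_nil mul1mx simple_pos.
move=> /simple_word_cons[sb sA]; have WA := weyl_rprod sA.
have [Aa|/(ih sA)[B [sB szB eB]] _] := boolP (rprod A *m a \in P); last first.
  exists (b :: B); split; [by apply/simple_word_cons|by rewrite /= szB|].
  by rewrite !rprod_cons eB mulmxA.
rewrite rprod_cons -mulmxA => bAa; exists A; split=> //.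
have eb : rprod A *m a = b.
  by apply/eqP; apply: contraR bAa => /simple_refl_pos; apply.
rewrite -mulmxA -refl_conj ?weyl_orth // eb mulmxA refl_mul_self ?mul1mx //.
exact/root_neq0/simple_phi.
Qed.

(** In a word with a letter, the exchange lemma applied to the last letter
    gives a shorter word for the same element. *)
Lemma pos_stable_eq1 w : W w -> (forall x, x \in P -> w *m x \in P) -> w = 1%:M.
Proof.
move=> /weyl_word[A + ->].
move: {2}_.+1 (ltnSn (size A)) => n; elim: n A => // n ih A; rewrite ltnS.
case/lastP: A => [|A a]; first by rewrite rprod_nil.
rewrite size_rcons -cats1 => An /simple_word_cat[sA /simple_word_cons[sa _]].
rewrite cats1 rprod_rcons => Apos.
have a0 : a != 0 by apply/root_neq0/simple_phi.
have [B [sB szB eB]] : exists B, [/\ simple_word B, size A = (size B).+1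
    & rprod B = rprod A *m refl a].
  apply: exchange => //; rewrite -posN; last first.
    by apply: weyl_root; [apply: weyl_rprod|apply: simple_phi].
  rewrite -mulmxN -refl_self // mulmxA.
  exact/Apos/simple_pos.
rewrite -eB; apply: ih => //; last by rewrite eB.
by rewrite (leq_trans _ An) // szB.
Qed.

Lemma inv_set_inj u v : W u -> W v ->
  (forall x, x \in P -> (x \in I u) = (x \in I v)) -> u = v.
Proof.
move=> Wu Wv uv.
have eqI x : x \in Phi -> (x \in I u) = (x \in I v).
  move=> hx; have [Px|nPx] := boolP (x \in P); first exact: uv.
  by apply/negb_inj; rewrite -!mem_invN //; apply: uv; rewrite posN.
have : v^T *m u = 1%:M.
  apply: pos_stable_eq1; first by apply: weyl_mul => //; apply: weyl_tr.
  move=> x Px; have hx := pos_root Px; apply/negPn; rewrite -mulmxA.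
  by rewrite -mem_inv ?weyl_root // -eqI ?weyl_root // mem_inv_image // Px.
by move=> /(congr1 (mulmx v)); rewrite mulmxA weyl_orthC // mul1mx mulmx1.
Qed.

(** ** Inversions along a word *)

Lemma inv_refl_other u a x : W u -> simple_root P a -> x \in Phi ->
  x != u *m a -> x != - (u *m a) -> (x \in I (u *m refl a)) = (x \in I u).
Proof.
move=> Wu sa hx xa xNa; have Wa := simple_weyl sa; have ha := simple_phi sa.
have Wut := weyl_tr Wu.
rewrite !mem_inv //; last exact: weyl_mul.
rewrite trmx_mul trmx_refl -mulmxA; set y := u^T *m x.
have hy : y \in Phi by apply: weyl_root.
have ya : y != a by apply: contra xa => /eqP <-; rewrite weylKV.
have yNa : - y != a by apply: contra xNa => /eqP <-; rewrite mulmxN opprK weylKV.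
have [Py|] := boolP (y \in P); first by rewrite simple_refl_pos.
rewrite -!posN // ?refl_root //.
by move=> Py; rewrite -[X in X \in P]mulmxN simple_refl_pos.
Qed.

Lemma inv_refl_self u a : W u -> simple_root P a -> u *m a \in I (u *m refl a).
Proof.
move=> Wu sa; have ha := simple_phi sa; have Wa := simple_weyl sa.
rewrite mem_inv ?weyl_root //; last exact: weyl_mul.
rewrite trmx_mul trmx_refl -mulmxA weylK // refl_self ?root_neq0 //.
by rewrite posN // simple_pos.
Qed.

Lemma notin_inv_simple u a : W u -> simple_root P a -> u *m a \notin I u.
Proof. by move=> Wu sa; rewrite mem_inv_image ?simple_phi // simple_pos. Qed.

Lemma inv_refl_diff u a : W u -> simple_root P a ->
  I (u *m refl a) `\` I u = [fset u *m a].
Proof.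
move=> Wu sa; have ha := simple_phi sa; apply/fsetP => x; rewrite in_fsetD in_fset1.
have [->|xa] := eqVneq x (u *m a).
  by rewrite inv_refl_self // notin_inv_simple.
have [hx|/negP nx] := boolP (x \in Phi); last first.
  by apply/andP => -[_ /inv_root].
have [->|xNa] := eqVneq x (- (u *m a)).
  rewrite !mem_invN ?weyl_root ?inv_refl_self ?andbF //.
  by apply: weyl_mul => //; apply: simple_weyl.
by rewrite (inv_refl_other Wu sa hx xa xNa) andNb.
Qed.

Lemma inv_word_split u A x : W u -> simple_word A -> x \in Phi ->
  x \notin I u -> x \in I (u *m rprod A) ->
  exists A1 a A2, A = A1 ++ a :: A2 /\ x = u *m rprod A1 *m a.
Proof.
move=> + + hx; elim: A u => [|a A ih] u Wu.
  by rewrite rprod_nil mulmx1 => _ /negPf ->.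
move=> /simple_word_cons[sa sA] xu; rewrite rprod_cons mulmxA => xuA.
have Wua : W (u *m refl a) by apply: weyl_mul => //; apply: simple_weyl.
have [xua|xua] := boolP (x \in I (u *m refl a)).
  exists [::], a, A; split=> //; rewrite rprod_nil mulmx1.
  by apply/fset1P; rewrite -inv_refl_diff // in_fsetD xu.
have [A1 [b [A2 [-> ->]]]] := ih _ Wua sA xua xuA.
by exists (a :: A1), b, A2; rewrite rprod_cons !mulmxA.
Qed.

(** Every positive root is inverted at some letter of a word whose inversion
    set is all of P. *)
Lemma size_longest_word A :
  simple_word A -> I (rprod A) = P -> (#|` P| <= size A)%N.
Proof.
move=> sA IA; rewrite -(size_iota 0 (size A)).
rewrite -(size_map (fun k => rprod (take k A) *m nth 0 A k)).
apply: uniq_leq_size; first exact: fset_uniq.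
move=> x Px; have hx := pos_root Px.
have [||A1 [a [A2 [-> ->]]]] := inv_word_split (weyl_one Phi) sA hx.
- by rewrite mem_inv1 // Px.
- by rewrite mul1mx IA.
apply/mapP; exists (size A1).
  by rewrite mem_iota size_cat /= addnS ltnS leq_addr.
by rewrite mul1mx take_size_cat // nth_cat ltnn subnn.
Qed.

(** * Condorcet domains *)

Lemma condorcet_weyl D u : condorcet Phi P D -> u \in D -> W u.
Proof. by case=> -[_ h] _; apply: h. Qed.

(** The definition of a Condorcet domain asks for distinct roots and distinct
    elements; here both follow from inv_set_pointed. *)
Lemma condorcet_triple D u v w a b c (r s t : R) : condorcet Phi P D ->
  u \in D -> v \in D -> w \in D ->
  0 < r -> 0 < s -> 0 < t -> r *: a + s *: b + t *: c = 0 ->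
  a \in I u -> b \in I u -> a \in I v -> c \in I v -> b \in I w -> c \in I w ->
  False.
Proof.
move=> cD uD vD wD r0 s0 t0 abc au bu av cv bw cw.
have pointed z : z \in D -> a \in I z -> b \in I z -> c \in I z -> False.
  by move=> zD; apply: (inv_set_pointed (condorcet_weyl cD zD) r0 s0 t0 abc).
have cu : c \notin I u by apply/negP; apply: pointed.
have bv : b \notin I v by apply/negP => bv; apply: (pointed v).
have aw : a \notin I w by apply/negP => aw; apply: (pointed w).
have neq (x y : 'M[R]_d) z : z \in I x -> z \notin I y -> x <> y.
  by move=> + + exy; rewrite exy => ->.
case: cD => _; apply; exists u, v, w, a, b, c; split=> //.
- split.
  + exact/nesym/(neq _ _ c).
  + exact: (neq _ _ a).
  + exact: (neq _ _ a).
split; first by split; [exact: inv_root au|exact: inv_root bu|exact: inv_root cv].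
- split=> e.
  + by move: bv; rewrite -e av.
  + by move: cu; rewrite -e au.
  + by move: cu; rewrite -e bu.
by exists r, s, t.
Qed.

Definition majority3 u v w x :=
  [|| (x \in I u) && (x \in I v), (x \in I u) && (x \in I w)
    | (x \in I v) && (x \in I w)].

(** Each of the three voters holds at most two of the three roots, so six
    memberships force the forbidden pattern. *)
Lemma majority3_triple D u v w a b c (r s t : R) : condorcet Phi P D ->
  u \in D -> v \in D -> w \in D ->
  0 < r -> 0 < s -> 0 < t -> r *: a + s *: b + t *: c = 0 ->
  majority3 u v w a -> majority3 u v w b -> majority3 u v w c -> False.
Proof.
move=> cD uD vD wD r0 s0 t0 abc.
have pointed z : z \in D -> a \in I z -> b \in I z -> c \in I z -> False.
  by move=> zD; apply: (inv_set_pointed (condorcet_weyl cD zD) r0 s0 t0 abc).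
have triple (x y z : 'M[R]_d) : x \in D -> y \in D -> z \in D ->
    a \in I x -> b \in I x -> a \in I y -> c \in I y ->
    b \in I z -> c \in I z -> False.
  by move=> xD yD zD; apply: (condorcet_triple cD xD yD zD r0 s0 t0 abc).
move: (pointed u uD) (pointed v vD) (pointed w wD).
move: (triple u v w uD vD wD) (triple u w v uD wD vD) (triple v u w vD uD wD).
move: (triple v w u vD wD uD) (triple w u v wD uD vD) (triple w v u wD vD uD).
(* Only the nine memberships matter from here on, as unknown booleans. *)
rewrite /majority3 {pointed triple}.
do 3 (move: (_ \in I u) (_ \in I v) (_ \in I w)).
move=> ??? ??? ??? ?????????.
by move=> /or3P[]/andP[] ?? /or3P[]/andP[] ?? /or3P[]/andP[] ??; auto.
Qed.

Lemma sum_indicator (D : {fset 'M[R]_d}) (p : pred 'M[R]_d) (u : 'M[R]_d) :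
  u \in D -> (\sum_(z : D | p (val z)) (val z == u))%N = p u.
Proof.
move=> uD; rewrite big_mkcond (bigD1 [` uD]) //= eqxx big1 => [|z zu].
  by case: (p u).
case: ifP => // _; apply/eqP; rewrite eqb0; apply: contra zu => /eqP e.
by apply/eqP/val_inj.
Qed.

(** One vote for each of u, v and w; three votes cannot tie. *)
Lemma closed_majority3 D u v w (x : 'M[R]_d) : closed_condorcet Phi P D ->
  u \in D -> v \in D -> w \in D -> W x ->
  (forall y, y \in I x -> majority3 u v w y) -> x \in D.
Proof.
move=> [cD nuD] uD vD wD Wx maj; apply/nuD.
pose f (z : D) := ((val z == u) + (val z == v) + (val z == w))%N.
have tot : total_votes f = 3.
  have split3 (p : pred 'M[R]_d) :
      (\sum_(z : D | p (val z)) f z)%N = (p u + p v + p w)%N.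
    by rewrite !big_split /= !sum_indicator.
  exact: (split3 xpredT).
have votesE y : votes Phi P f y = ((y \in I u) + (y \in I v) + (y \in I w))%N.
  rewrite /votes !big_split /=.
  by rewrite !(@sum_indicator D (fun z => y \in I z)).
exists f; split.
- by exists [` uD]; rewrite /f /= eqxx.
- by move=> y _; rewrite votesE tot; do 3 case: (y \in _) => //=; move/eqP.
split=> //; apply/fsubsetP => y yx; rewrite !inE /= (inv_root yx) votesE tot.
by have := maj y yx; rewrite /majority3; do 3 case: (y \in _).
Qed.

(** A larger Condorcet domain containing x would have to violate the
    condition on some triple, where x can be replaced by its lookalike. *)
Lemma maximal_mem D (x : 'M[R]_d) : maximal_condorcet Phi P D -> W x ->
  (forall a b c (r s t : R), a \in Phi -> b \in Phi -> c \in Phi ->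
     0 < r -> 0 < s -> 0 < t -> r *: a + s *: b + t *: c = 0 ->
     exists2 y, y \in D & {in [:: a; b; c], forall z, (z \in I x) = (z \in I y)}) ->
  x \in D.
Proof.
move=> [cD maxD] Wx like; apply/negPn/negP => xD; apply: maxD.
exists (x |` D); split; last by apply: fproperUr; rewrite fsub1set.
case: (cD) => -[D0 WD] _; split.
  split; first by apply/fset0Pn; exists x; rewrite fset1U1.
  by move=> w /fset1UP[->//|/WD].
move=> [u [v [w [a [b [c [[uD vD wD] _ rtriple]]]]]]] [[au bu] [av cv] [bw cw]].
have [[ha hb hc] _ [r [s [t [[r0 s0 t0] abc]]]]] := rtriple.
have sub z : z \in x |` D -> exists2 y, y \in D &
    {in [:: a; b; c], forall e, (e \in I z) = (e \in I y)}.
  by move=> /fset1UP[->|zD]; [exact: (like _ _ _ r s t)|exists z].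
have [u' u'D eu] := sub u uD; have [v' v'D ev] := sub v vD.
have [w' w'D ew] := sub w wD.
by apply: (condorcet_triple cD u'D v'D w'D r0 s0 t0 abc);
  rewrite -?eu -?ev -?ew // !inE eqxx ?orbT.
Qed.

(** ** Sorting a word towards a member of the domain *)

(** If a and b were not orthogonal, u (refl a b) would be a positive
    combination of u a and u b, and u, u (refl a) (refl b) and w would show
    the forbidden pattern on - u b, - u a and u (refl a b). *)
Lemma inverted_orthogonal E u a b w : condorcet Phi P E ->
  u \in E -> u *m refl a *m refl b \in E -> w \in E ->
  simple_root P a -> simple_root P b -> a != b ->
  u *m a \notin I w -> u *m refl a *m b \in I w -> dot a b = 0.
Proof.
move=> cE uE vE wE sa sb ab aw bw.
have Wu := condorcet_weyl cE uE; have Ww := condorcet_weyl cE wE.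
have Wv := condorcet_weyl cE vE.
have ha := simple_phi sa; have hb := simple_phi sb.
have Wua : W (u *m refl a) by apply: weyl_mul => //; apply: simple_weyl.
apply/eqP/negPn/negP => ab0.
have k0 : 0 < - (2 * dot a b / dot a a).
  rewrite oppr_gt0 pmulr_llt0 ?invr_gt0 ?dot_gt0 ?root_neq0 // pmulr_rlt0 //.
  by rewrite lt_def eq_sym ab0 simple_dot_le0.
apply: (condorcet_triple cE uE vE wE ltr01 k0 ltr01 (a := - (u *m b))
  (b := - (u *m a)) (c := u *m refl a *m b)).
- rewrite -mulmxA reflE mulmxBr -scalemxAr !scale1r scalerN scaleNr opprK.
  by rewrite addrAC addrA addNr add0r addrC subrr.
- by rewrite mem_invN ?weyl_root // notin_inv_simple.
- by rewrite mem_invN ?weyl_root // notin_inv_simple.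
- have Pab : refl a *m b \in P by rewrite simple_refl_pos ?simple_pos // eq_sym.
  rewrite mem_invN ?weyl_root // mem_inv ?weyl_root // negbK.
  rewrite !trmx_mul !trmx_refl -!mulmxA weylK //; apply: simple_refl_pos => //.
  apply: contra ab0; rewrite reflE eq_sym -subr_eq0 opprB addrC subrK scaler_eq0.
  rewrite (negPf (root_neq0 ha)) orbF mulf_eq0 invr_eq0.
  by rewrite (gt_eqF (dot_gt0 (root_neq0 ha))) orbF mulf_eq0 pnatr_eq0.
- exact: inv_refl_self.
- by rewrite mem_invN ?weyl_root.
exact: bw.
Qed.

(** Bubble sort: Q stands for the words that the exchanges may reach, and the
    letters inverted by w are moved to the front one at a time. *)
Section Sorting.
Variables (Q : seq 'cV[R]_d -> Prop) (w : 'M[R]_d).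
Hypothesis Qswap : forall p a b q, Q (p ++ [:: a, b & q]) ->
  rprod p *m a \notin I w -> rprod p *m refl a *m b \in I w ->
  dot a b = 0 /\ Q (p ++ [:: b, a & q]).

Definition all_inverted u A :=
  forall A1 a A2, A = A1 ++ a :: A2 -> u *m rprod A1 *m a \in I w.
Definition none_inverted u A :=
  forall A1 a A2, A = A1 ++ a :: A2 -> u *m rprod A1 *m a \notin I w.

Lemma none_inverted_rcons u A a :
  none_inverted u (rcons A a) -> none_inverted u A /\ u *m rprod A *m a \notin I w.
Proof.
move=> h; split; last by apply: (h A a [::]); rewrite cats1.
by move=> A1 b A2 e; apply: (h A1 b (rcons A2 a)); rewrite e rcons_cat.
Qed.

Lemma bubble p q b r : Q (p ++ q ++ b :: r) -> none_inverted (rprod p) q ->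
  rprod p *m rprod q *m b \in I w -> Q (p ++ b :: q ++ r) /\ rprod p *m b \in I w.
Proof.
elim/last_ind: q r => [|q a ih] r; first by rewrite rprod_nil mulmx1.
rewrite cat_rcons catA => Qw /none_inverted_rcons[nq na].
rewrite rprod_rcons mulmxA -rprod_cat => bI.
have [|//|ab Q'] := Qswap Qw; first by rewrite rprod_cat.
rewrite cat_rcons; apply: ih => //; first by rewrite catA.
by move: bI; rewrite -[_ *m refl a *m b]mulmxA refl_fix // rprod_cat.
Qed.

Lemma sort_word p r : Q (p ++ r) -> all_inverted 1%:M p ->
  exists p' r',
    [/\ Q (p' ++ r'), all_inverted 1%:M p' & none_inverted (rprod p') r'].
Proof.
move: {2}_.+1 (ltnSn (size r)) => n; elim: n p r => // n ih p r; rewrite ltnS.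
(* q is the part of the word after p that has been scanned in vain. *)
suff scan q r' : (size (q ++ r') <= n)%N -> Q (p ++ q ++ r') ->
    all_inverted 1%:M p -> none_inverted (rprod p) q -> exists p' r',
    [/\ Q (p' ++ r'), all_inverted 1%:M p' & none_inverted (rprod p') r'].
  by move=> rn Qr ap; apply: (scan [::] r) => // -[].
elim: r' q => [|b r' ihr] q; first by rewrite cats0 => _ Qq ap nq; exists p, q.
move=> qn Qq ap nq; have [bI|bN] := boolP (rprod p *m rprod q *m b \in I w).
  have [Q' pb] := bubble Qq nq bI; apply: (ih (rcons p b) (q ++ r')).
  - by move: qn; rewrite !size_cat /= addnS.
  - by rewrite cat_rcons.
  move=> A1 a A2; case/lastP: A2 => [|A2 c].
    by rewrite cats1 => /rcons_inj[<- <-]; rewrite mul1mx.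
  by rewrite -rcons_cons -rcons_cat => /rcons_inj[ep _]; apply: (ap A1 a A2).
apply: (ihr (rcons q b)); rewrite ?cat_rcons // => A1 a A2.
case/lastP: A2 => [|A2 c].
  by rewrite cats1 => /rcons_inj[<- <-].
by rewrite -rcons_cons -rcons_cat => /rcons_inj[eq_ _]; apply: (nq A1 a A2).
Qed.

End Sorting.

(** A positive root is inverted either at a letter of p or at a letter of r,
    so w and the product of p have the same positive inversions. *)
Lemma sorted_prefix w p r : W w -> simple_word p -> simple_word r ->
  I (rprod (p ++ r)) = P -> all_inverted w 1%:M p -> none_inverted w (rprod p) r ->
  w = rprod p.
Proof.
move=> Ww sp sr Ipr ap nr; have Wp := weyl_rprod sp; apply: inv_set_inj => // x Px.
have hx := pos_root Px; have [xp|xp] := boolP (x \in I (rprod p)).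
  have [||A1 [a [A2 [ep ->]]]] := inv_word_split (weyl_one Phi) sp hx.
  - by rewrite mem_inv1 // Px.
  - by rewrite mul1mx.
  exact: (ap A1 a A2 ep).
have [|A1 [a [A2 [er ->]]]] := inv_word_split Wp sr hx xp.
  by rewrite -rprod_cat Ipr.
exact/negbTE/(nr A1 a A2 er).
Qed.

Lemma commutation_class_size (i j : seq 'M[R]_d) :
  commutation_class i j -> size j = size i.
Proof. by elim=> [//|p s t q _ <- _]; rewrite !size_cat. Qed.

Lemma commutation_class_prod (i j : seq 'M[R]_d) : commutation_class i j ->
  word_prod j = word_prod i.
Proof.
have cat (p q : seq 'M[R]_d) : word_prod (p ++ q) = word_prod p *m word_prod q.
  rewrite /word_prod; elim: p => [|s p ih]; first by rewrite big_nil mul1mx.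
  by rewrite /= !big_cons ih mulmxA.
elim=> [//|p s t q _ <- st]; rewrite !cat /word_prod !big_cons.
by rewrite (mulmxA t s) -st -mulmxA.
Qed.

Definition shortest_word A :=
  forall B, simple_word B -> rprod B = rprod A -> (size A <= size B)%N.

(** A Condorcet domain that contains the prefixes of a commutation class of
    words for the longest element contains nothing else: every word of the
    class can be sorted so that the inversions of w come first. *)
Lemma mem_prefix E A w : condorcet Phi P E -> simple_word A -> I (rprod A) = P ->
  shortest_word A ->
  (forall j k, commutation_class [seq refl a | a <- A] j -> (k <= size A)%N ->
     word_prod (take k j) \in E) ->
  w \in E -> exists j k, [/\ commutation_class [seq refl a | a <- A] j,
    (k <= size A)%N & w = word_prod (take k j)].
Proof.
move=> cE sA IA minA prefE wE; have Ww := condorcet_weyl cE wE.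
pose Q B := simple_word B /\
  commutation_class [seq refl a | a <- A] [seq refl a | a <- B].
have sizeQ B : Q B -> size B = size A.
  by case=> _ /commutation_class_size; rewrite !size_map.
have prodQ B : Q B -> rprod B = rprod A by case=> _ /commutation_class_prod.
have prefQ p q : Q (p ++ q) -> rprod p \in E.
  move=> Qpq; have [_ cpq] := Qpq; have := prefE _ (size p) cpq.
  by rewrite -map_take take_size_cat // -(sizeQ _ Qpq) size_cat leq_addr => ->.
have Qswap p a b q : Q (p ++ [:: a, b & q]) ->
    rprod p *m a \notin I w -> rprod p *m refl a *m b \in I w ->
    dot a b = 0 /\ Q (p ++ [:: b, a & q]).
  move=> Qj aw bw; have [/simple_word_cat[sp]] := Qj.
  move=> /simple_word_cons[sa /simple_word_cons[sb sq]] cj.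
  have ab : a != b.
    apply/eqP => eab; have := minA (p ++ q); rewrite -(prodQ _ Qj) -(sizeQ _ Qj).
    rewrite !rprod_cat -eab !rprod_cons mulmxA mulmxA.
    have a0 := root_neq0 (simple_phi sa).
    rewrite -[rprod p *m _ *m _]mulmxA refl_mul_self // mulmx1.
    rewrite !size_cat /= !addnS => h.
    have := h ((simple_word_cat _ _).2 (conj sp sq)) erefl.
    by rewrite ltnNge leqnSn.
  have ab0 : dot a b = 0.
    apply: (inverted_orthogonal cE (prefQ p _ Qj) _ wE sa sb ab aw bw).
    rewrite -!rprod_rcons; apply: (prefQ _ q).
    by rewrite !cat_rcons.
  split; first exact: ab0.
  split.
    apply/simple_word_cat; split; first exact: sp.
    by apply/simple_word_cons; split; last exact/simple_word_cons.
  by move: cj; rewrite !map_cat /=; move/commutation_step; apply; apply: refl_commute.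
have QA : Q ([::] ++ A) by split=> //; apply: commutation_refl.
have [p [r [Qpr ap nr]]] : exists p r, [/\ Q (p ++ r), all_inverted w 1%:M p
    & none_inverted w (rprod p) r].
  by apply: (sort_word Qswap QA) => -[].
have [/simple_word_cat[sp sr] cpr] := Qpr.
exists [seq refl a | a <- p ++ r], (size p); split=> //.
  by rewrite -(sizeQ _ Qpr) size_cat leq_addr.
rewrite -map_take take_size_cat //; apply: (sorted_prefix Ww sp sr) => //.
by rewrite prodQ.
Qed.

(** ** Exchanging commuting letters *)

(** If the reflections commute, refl a negates refl b a, which is therefore a
    multiple of a; being positive, it is a itself. *)
Lemma commute_orthogonal a b : simple_root P a -> simple_root P b -> a != b ->
  refl a *m refl b = refl b *m refl a -> dot a b = 0.
Proof.
move=> sa sb ab com; have ha := simple_phi sa; have hb := simple_phi sb.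
have Pba : refl b *m a \in P by apply: simple_refl_pos => //; apply: simple_pos.
have : refl a *m (refl b *m a) = - (refl b *m a).
  by rewrite mulmxA com -mulmxA refl_self ?root_neq0 // mulmxN.
rewrite reflE; set y := refl b *m a; set k := _ / _ => ey.
have yy : y + y = k *: a by rewrite -{2}[y]opprK -ey opprB addrC subrK.
have eya : y = (k / 2) *: a.
  rewrite mulrC -scalerA -yy -mulr2n -scaler_nat scalerA mulVf ?pnatr_eq0 //.
  by rewrite scale1r.
have := pos_line (simple_pos sa) Pba eya; rewrite /y reflE => /eqP.
rewrite eq_sym -subr_eq0 opprB addrC subrK scaler_eq0 (negPf (root_neq0 hb)) orbF.
rewrite mulf_eq0 invr_eq0 (gt_eqF (dot_gt0 (root_neq0 hb))) orbF mulf_eq0 pnatr_eq0 /=.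
by rewrite dotC => /eqP.
Qed.

(** Reflecting such a root, if positive, in a and in b would give two opposite
    positive roots. *)
Lemma orthogonal_simple_plane a b y (m n : R) :
  simple_root P a -> simple_root P b -> dot a b = 0 -> m != 0 -> n != 0 ->
  y = m *: a + n *: b -> y \notin Phi.
Proof.
move=> sa sb ab.
have a0 := root_neq0 (simple_phi sa); have b0 := root_neq0 (simple_phi sb).
have ba : dot b a = 0 by rewrite dotC.
have pos z (i j : R) : i != 0 -> j != 0 -> z = i *: a + j *: b -> z \in P -> False.
  move=> i0 j0 ez Pz.
  have za : z != a.
    apply: contra j0 => /eqP e; have := congr1 (dot b) ez.
    rewrite e dotDr !dotZr ba mulr0 add0r => /esym/eqP.
    by rewrite mulf_eq0 (gt_eqF (dot_gt0 b0)) orbF.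
  have zb : z != b.
    apply: contra i0 => /eqP e; have := congr1 (dot a) ez.
    rewrite e dotDr !dotZr ab mulr0 addr0 => /esym/eqP.
    by rewrite mulf_eq0 (gt_eqF (dot_gt0 a0)) orbF.
  have := pos_gt0 (simple_refl_pos sa Pz za).
  have := pos_gt0 (simple_refl_pos sb Pz zb).
  rewrite ez !mulmxDr -!scalemxAr !refl_self // !refl_fix //.
  by rewrite !dotDr !dotZr !dotNr; lra.
move=> m0 n0 ey; apply/negP => hy; have [Py|nPy] := boolP (y \in P).
  exact: (pos y m n).
apply: (pos (- y) (- m) (- n)); rewrite ?oppr_eq0 //; last by rewrite posN.
by rewrite ey opprD !scaleNr.
Qed.

(** By orthogonal_simple_plane no root triple contains multiples of both u a
    and u b. So on each triple u (refl b) looks like u, from which it differs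
    in u b only, or like u (refl a) (refl b), from which it differs in u a
    only. *)
Lemma maximal_exchange D u a b : maximal_condorcet Phi P D ->
  u \in D -> u *m refl a *m refl b \in D -> simple_root P a -> simple_root P b ->
  dot a b = 0 -> u *m refl b \in D.
Proof.
move=> mD uD vD sa sb ab; have [cD _] := mD; have Wu := condorcet_weyl cD uD.
have Wx : W (u *m refl b) by apply: weyl_mul => //; apply: simple_weyl.
have ha := simple_phi sa; have hb := simple_phi sb.
have ba : dot b a = 0 by rewrite dotC.
have vE : u *m refl a *m refl b = u *m refl b *m refl a.
  by rewrite -!mulmxA refl_commute.
have xa : u *m refl b *m a = u *m a by rewrite -mulmxA refl_fix.
apply: (maximal_mem mD Wx) => c1 c2 c3 r s t h1 h2 h3 r0 s0 t0 rel.
pose off y x := (x != u *m y) && (x != - (u *m y)).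
have like_u x : x \in Phi -> off b x -> (x \in I (u *m refl b)) = (x \in I u).
  by move=> hx /andP[]; apply: inv_refl_other.
have like_v x : x \in Phi -> off a x ->
    (x \in I (u *m refl b)) = (x \in I (u *m refl a *m refl b)).
  move=> hx /andP[xn xNn]; rewrite vE; symmetry.
  by apply: (inv_refl_other Wx sa hx); rewrite xa.
have phi3 : {in [:: c1; c2; c3], forall x, x \in Phi}.
  by move=> x; rewrite !inE => /or3P[]/eqP->.
have [/allP offb|] := boolP (all (off b) [:: c1; c2; c3]).
  by exists u => // x cx; apply: like_u; [apply: phi3|apply: offb].
have [/allP offa _|] := boolP (all (off a) [:: c1; c2; c3]).
  exists (u *m refl a *m refl b) => // x cx.
  by apply: like_v; [apply: phi3|apply: offa].
have line y x : ~~ off y x -> exists2 k, k != 0 & u^T *m x = k *: y.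
  rewrite negb_and !negbK => /orP[]/eqP->; last rewrite mulmxN.
    by exists 1; rewrite ?oner_eq0 // weylK // scale1r.
  by exists (-1); rewrite ?oppr_eq0 ?oner_eq0 // weylK // scaleN1r.
have plane x y z (i j k : R) : z \in Phi -> 0 < i -> 0 < j -> 0 < k ->
    i *: x + j *: y + k *: z = 0 -> ~~ off a x -> ~~ off b y -> False.
  move=> hz i0 j0 k0 eq0 /line[m m0 xm] /line[n n0 yn].
  have : u^T *m z \notin Phi; last first.
    by rewrite weyl_root //; apply: weyl_tr.
  apply: (orthogonal_simple_plane (m := - (k^-1 * i * m))
    (n := - (k^-1 * j * n)) sa sb ab).
  - by rewrite oppr_eq0 !mulf_eq0 invr_eq0 (gt_eqF k0) (gt_eqF i0).
  - by rewrite oppr_eq0 !mulf_eq0 invr_eq0 (gt_eqF k0) (gt_eqF j0).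
  apply: (scalerI (lt0r_neq0 k0)).
  rewrite scalerDr !scalerA !mulrN !mulrA divff ?gt_eqF // !mul1r.
  have := congr1 (mulmx u^T) eq0; rewrite mulmx0 !mulmxDr -!scalemxAr.
  rewrite xm yn !scalerA.
  by rewrite addrC => /eqP; rewrite addr_eq0 => /eqP ->; rewrite opprD !scaleNr.
have both x : ~~ off a x -> ~~ off b x -> False.
  move=> /line[m m0 xm] /line[n n0]; rewrite xm => /(congr1 (dot a)) /eqP.
  by rewrite !dotZr ab mulr0 mulf_eq0 (negPf m0) (gt_eqF (dot_gt0 (root_neq0 ha))).
have rel1 : r *: c1 + t *: c3 + s *: c2 = 0 by rewrite addrAC.
have rel2 : s *: c2 + t *: c3 + r *: c1 = 0 by rewrite addrC addrA.
have rel3 : s *: c2 + r *: c1 + t *: c3 = 0 by rewrite [s *: _ + _]addrC.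
have rel4 : t *: c3 + r *: c1 + s *: c2 = 0 by rewrite [t *: _ + _]addrC.
have rel5 : t *: c3 + s *: c2 + r *: c1 = 0 by rewrite [t *: _ + _]addrC.
move=> /allPn[x1 + oa] /allPn[x2 + ob].
rewrite !inE => /or3P[]/eqP e1 /or3P[]/eqP e2;
  move: oa ob; rewrite {}e1 {}e2 => oa ob; exfalso;
  first [exact: both oa ob|exact: (plane _ _ _ _ _ _ _ _ _ _ rel oa ob)
        |exact: (plane _ _ _ _ _ _ _ _ _ _ rel1 oa ob)
        |exact: (plane _ _ _ _ _ _ _ _ _ _ rel2 oa ob)
        |exact: (plane _ _ _ _ _ _ _ _ _ _ rel3 oa ob)
        |exact: (plane _ _ _ _ _ _ _ _ _ _ rel4 oa ob)
        |exact: (plane _ _ _ _ _ _ _ _ _ _ rel5 oa ob)].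
Qed.

Definition prefixes_in (D : {fset 'M[R]_d}) A := forall k, rprod (take k A) \in D.

Lemma prefixes_in_cat D p q : prefixes_in D (p ++ q) -> rprod p \in D.
Proof. by move=> /(_ (size p)); rewrite take_size_cat. Qed.

Lemma prefixes_in_rcons D A a : prefixes_in D A -> rprod (rcons A a) \in D ->
  prefixes_in D (rcons A a).
Proof.
move=> pA Aa k; have [kA|Ak] := leqP k (size A); last first.
  by rewrite take_oversize // size_rcons.
by rewrite -cats1 takel_cat.
Qed.

Lemma roots_of_word (i : seq 'M[R]_d) :
  (forall s, s \in i -> simple_reflection P s) ->
  exists2 A, simple_word A & i = [seq refl a | a <- A].
Proof.
elim: i => [|s i ih] si; first by exists [::].
have [t ti|A sA ->] := ih; first by apply: si; rewrite in_cons ti orbT.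
have [a sa ->] := si s (mem_head _ _).
by exists (a :: A) => //; apply/simple_word_cons.
Qed.

Lemma commutation_class_simple A (j : seq 'M[R]_d) : simple_word A ->
  commutation_class [seq refl a | a <- A] j ->
  exists2 B, simple_word B & j = [seq refl b | b <- B].
Proof.
move=> sA cj; apply: roots_of_word; elim: cj => [|p s t q _ ih _] x.
  by move=> /mapP[a /sA sa ->]; exists a.
by move=> hx; apply: ih; move: hx; rewrite !mem_cat !in_cons [(x == t) || _]orbCA.
Qed.

(** An exchange changes only the prefix that ends between the two letters, and
    maximal_exchange puts the new one into D. *)
Lemma commutation_class_prefixes D A j : maximal_condorcet Phi P D ->
  simple_word A -> prefixes_in D A ->
  commutation_class [seq refl a | a <- A] j ->
  exists B, [/\ simple_word B, j = [seq refl b | b <- B] & prefixes_in D B].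
Proof.
move=> mD sA pA; elim=> [|p s t q _ [B [sB eB pB]] st]; first by exists A.
have eqB := cat_take_drop (size p) B.
have ep : p = [seq refl b | b <- take (size p) B].
  by rewrite map_take -eB take_size_cat.
have : [:: s, t & q] = [seq refl b | b <- drop (size p) B].
  by rewrite map_drop -eB drop_size_cat.
move: eqB ep; move: (take _ B) (drop _ B) => p' [|a [|b q']] // eqB ep [es et eq].
move: sB pB; rewrite -{}eqB => /simple_word_cat[sp].
move=> /simple_word_cons[sa /simple_word_cons[sb sq]] pB.
exists (p' ++ [:: b, a & q']); split.
- apply/simple_word_cat; split; first exact: sp.
  by apply/simple_word_cons; split; last exact/simple_word_cons.
- by rewrite map_cat /= ep es et eq.
have pD : rprod p' \in D by apply: prefixes_in_cat pB.
have pabD : rprod p' *m refl a *m refl b \in D.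
  by rewrite -!rprod_rcons; apply: (@prefixes_in_cat _ _ q'); rewrite !cat_rcons.
have paD : rprod p' *m refl a \in D.
  rewrite -!rprod_rcons; apply: (@prefixes_in_cat _ _ (b :: q')).
  by rewrite !cat_rcons.
have pbD : rprod p' *m refl b \in D.
  have [<-|ab] := eqVneq a b; first exact: paD.
  apply: (maximal_exchange mD pD pabD sa sb); apply: commute_orthogonal => //.
  by rewrite -es -et.
move=> k; rewrite take_cat; case: ltnP => [kp|pk].
  by have := pB k; rewrite take_cat kp.
case e: (k - size p')%N => [|[|m]]; first by rewrite cats0.
  by rewrite /= ?take0 cats1 rprod_rcons.
have := pB k; rewrite take_cat ltnNge pk e /= !rprod_cat !rprod_cons !mulmxA.
by rewrite -!(mulmxA (rprod p')) -es -et st.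
Qed.

(** ** Monotone paths in closed domains *)

(** The positive roots in the majority of w0, w and x are the positive
    inversions of w together with w b. If b were not simple, it would be a
    positive combination of two other positive roots; the negatives of their
    images under w lie in the majority as well, and together with w b they
    contradict majority3_triple. So b is simple, and the majority is the
    inversion set of w (refl b). *)
Lemma closed_add_inversion D w0 w (x : 'M[R]_d) b : closed_condorcet Phi P D ->
  w0 \in D -> I w0 = P -> w \in D -> x \in D -> b \in P ->
  w *m b \in P -> w *m b \in I x ->
  (forall y, y \in P -> y \in I x -> y \in I w \/ y = w *m b) ->
  simple_root P b /\ w *m refl b \in D.
Proof.
move=> clD w0D Iw0 wD xD Pb Pwb xwb xsub; have [cD _] := clD.
have Ww := condorcet_weyl cD wD; have Wx := condorcet_weyl cD xD.
have hb := pos_root Pb.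
have majb : majority3 w0 w x (w *m b) by rewrite /majority3 Iw0 Pwb xwb orbT.
have majN y : y \in Phi -> y \notin I w -> y != w *m b -> majority3 w0 w x (- y).
  move=> hy yw yb; rewrite /majority3 Iw0 !mem_invN // yw posN //=.
  have [Py|//] := boolP (y \in P); rewrite /=.
  apply/negP => yx; case: (xsub y Py yx) => [yw'|/eqP]; last by rewrite (negPf yb).
  by rewrite yw' in yw.
have sb : simple_root P b.
  apply: contrapT => nb; have [a [c [sa c0 Pab eb]]] := nonsimple_split Pb nb.
  have ha := simple_phi sa.
  have injw y z : w *m y = w *m z -> y = z.
    by move=> e; rewrite -(weylK y Ww) e weylK.
  apply: (majority3_triple cD w0D wD xD ltr01 ltr01 c0 (a := w *m b)
    (b := - (w *m (refl a *m b))) (c := - (w *m a))).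
  - by rewrite {1}eb mulmxDr -scalemxAr !scale1r scalerN addrAC addrK subrr.
  - exact: majb.
  - apply: majN; [exact: weyl_root Ww (pos_root Pab)| |].
      by rewrite (mem_inv_image Ww (pos_root Pab)) Pab.
    apply/eqP => /injw e; move: eb; rewrite e => /eqP.
    rewrite eq_sym addrC -subr_eq0 addrK scaler_eq0 (gt_eqF c0).
    by rewrite (negPf (root_neq0 ha)).
  apply: majN; [exact: weyl_root Ww ha|exact: notin_inv_simple|].
  by apply/eqP => /injw e; apply: nb; rewrite -e.
split; first exact: sb.
have Wwb : W (w *m refl b) by apply: weyl_mul => //; apply: simple_weyl.
apply: (closed_majority3 clD w0D wD xD Wwb) => y hy; have Py := inv_root hy.
have [->//|yb] := eqVneq y (w *m b).
have yNb : y != - (w *m b).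
  by apply: contraTneq hy => ->; rewrite mem_invN ?weyl_root // inv_refl_self.
rewrite -[y]opprK; apply: majN; rewrite ?rootN // ?mem_invN ?negbK //.
  by rewrite -(inv_refl_other Ww sb).
by apply: contra yNb => /eqP <-; rewrite opprK.
Qed.

(** Along the path the word A collects the positive inversions met so far. The
    equation on its size says that it is reduced: each letter adds a new
    positive inversion. *)
Lemma monotone_path D w0 p u A : closed_condorcet Phi P D ->
  w0 \in D -> I w0 = P -> u \in D -> {subset p <= D} ->
  path (fun x y : 'M[R]_d => #|` I y `\` I x| == 1%N) u p -> last u p = w0 ->
  simple_word A -> prefixes_in D A ->
  (size A + #|` P `\` I (rprod A)|)%N = #|` P| ->
  (forall x, x \in P -> x \in I u -> x \in I (rprod A)) ->
  exists B, [/\ simple_word B, prefixes_in D B, size B = #|` P| & rprod B = w0].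
Proof.
move=> clD w0D Iw0; have [cD _] := clD.
elim: p u A => [|x p ih] u A uD pD /=.
  move=> _ eu sA pA szA sub; exists A; split=> //.
    rewrite -szA.
    have -> : P `\` I (rprod A) = fset0; last by rewrite cardfs0 addn0.
    apply/fsetP => x; rewrite in_fsetD in_fset0; apply/negP => /andP[/negP nx Px].
    by apply/nx/sub => //; rewrite eu Iw0.
  apply: inv_set_inj; [exact: weyl_rprod|exact: condorcet_weyl cD w0D|].
  by move=> x Px; rewrite Iw0 Px; apply: sub => //; rewrite eu Iw0.
have xD : x \in D by apply: pD; rewrite mem_head.
have {}pD : {subset p <= D} by move=> y yp; apply: pD; rewrite in_cons yp orbT.
move=> /andP[/cardfs1P[y exy] px] lx sA pA szA sub.
have AD : rprod A \in D by have := pA (size A); rewrite take_size.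
have Iux z : z \in I x -> z \in I u \/ z = y.
  move=> zx; have [|zu] := boolP (z \in I u); first by left.
  by right; apply/fset1P; rewrite -exy in_fsetD zu.
have [/andP[Py yA]|yPA] := boolP ((y \in P) && (y \notin I (rprod A))); last first.
  apply: (ih x A) => // z Pz /Iux[/(sub z Pz)//|ezy]; apply/negPn.
  by move: yPA; rewrite -ezy Pz.
have WA := weyl_rprod sA; have hy := pos_root Py.
pose b := (rprod A)^T *m y; have eyb : rprod A *m b = y by apply: weylKV.
have Pb : b \in P by move: yA; rewrite mem_inv // negbK.
have yx : y \in I x by have := fset11 y; rewrite -exy in_fsetD => /andP[].
have [|||sb bD] := @closed_add_inversion D w0 (rprod A) x b clD w0D Iw0 AD xD Pb.
- by rewrite eyb.
- by rewrite eyb.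
- by move=> z Pz /Iux[/(sub z Pz)|]; [left|right; rewrite eyb].
apply: (ih x (rcons A b)) => //.
- by move=> a; rewrite mem_rcons in_cons => /predU1P[->//|/sA].
- by apply: prefixes_in_rcons; rewrite ?rprod_rcons.
- rewrite -szA size_rcons addSnnS rprod_rcons; congr (_ + _)%N.
  rewrite [RHS](cardfsD1 y) in_fsetD Py yA add1n; congr (#|` _|).+1.
  apply/fsetP => z; rewrite in_fsetD1 !in_fsetD.
  have [->|zy] := eqVneq z y; first by rewrite -eyb inv_refl_self.
  have [Pz|] := boolP (z \in P); last by rewrite !andbF.
  rewrite inv_refl_other ?eyb ?pos_root //.
  by apply: contraTneq Pz => ->; rewrite posN // Py.
move=> z Pz /Iux; rewrite rprod_rcons; have [->|zy] := eqVneq z y.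
  by move=> _; rewrite -eyb inv_refl_self.
case=> [zu|/eqP]; last by rewrite (negPf zy).
rewrite inv_refl_other ?eyb ?pos_root ?sub //.
by apply: contraTneq Pz => ->; rewrite posN // Py.
Qed.

(** ** Tiling domains *)

Definition linked (D : {fset 'M[R]_d}) (u v : 'M[R]_d) :=
  exists p : seq 'M[R]_d,
    [/\ {subset p <= D},
        path (fun x y : 'M[R]_d => #|` I y `\` I x| == 1%N) u p
      & last u p = v].

Lemma linked_trans D u v w : linked D u v -> linked D v w -> linked D u w.
Proof.
move=> [p [pD pp <-]] [q [qD pq <-]]; exists (p ++ q); split.
- by move=> x; rewrite mem_cat => /orP[/pD|/qD].
- by rewrite cat_path pp.
by rewrite last_cat.
Qed.

Lemma linked_refl_step D u a : W u -> simple_root P a -> u *m refl a \in D ->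
  linked D u (u *m refl a).
Proof.
move=> Wu sa uaD; exists [:: u *m refl a].
rewrite /= inv_refl_diff // cardfs1; split=> // x.
by rewrite inE => /eqP ->.
Qed.

(** Appending a simple reflection adds one signed root to the inversion set
    whether or not the length grows, so prefixes can be climbed both ways. *)
Lemma linked_prefixes D A : simple_word A -> prefixes_in D A ->
  linked D 1%:M (rprod A) /\ linked D (rprod A) 1%:M.
Proof.
elim/last_ind: A => [|A a ih].
  by move=> _ _; split; exists [::]; rewrite rprod_nil.
rewrite -cats1 => /simple_word_cat[sA /simple_word_cons[sa _]] pAa.
have pA : prefixes_in D A.
  move=> k; have [kA|Ak] := leqP k (size A); first by rewrite -(takel_cat [:: a]).
  by rewrite take_oversize ?(ltnW Ak) //; apply: prefixes_in_cat pAa.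
have AD := prefixes_in_cat pAa; have a0 := root_neq0 (simple_phi sa).
have AaD : rprod A *m refl a \in D.
  by have := pAa (size (A ++ [:: a])); rewrite take_size cats1 rprod_rcons.
have WA := weyl_rprod sA; have [up down] := ih sA pA.
have WAa : W (rprod A *m refl a) by apply: weyl_mul WA _; apply: simple_weyl.
have eA : rprod A *m refl a *m refl a = rprod A.
  by rewrite -mulmxA refl_mul_self // mulmx1.
rewrite cats1 rprod_rcons; split.
  exact: linked_trans up (linked_refl_step WA sa AaD).
apply: linked_trans down; rewrite -[X in linked _ _ X]eA.
by apply: linked_refl_step => //; rewrite eA.
Qed.

Lemma tiling_properties D w0 : longest Phi P w0 -> condorcet Phi P D ->
  tiling_type Phi P w0 D ->
  [/\ connected_domain Phi P D, maximal_width w0 D, maximal_condorcet Phi P D,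
      1%:M \in D & w0 \in D].
Proof.
move=> [_ Iw0] cD [_ [i [[si ei] mini] memD]].
have [A sA eA] := roots_of_word si.
have rA : rprod A = w0 by rewrite ei eA.
have szA : size i = size A by rewrite eA size_map.
have eD : 1%:M \in D.
  apply/memD; exists i, 0%N; split=> //; first exact: commutation_refl.
  by rewrite take0 /word_prod big_nil.
have w0D : w0 \in D.
  apply/memD; exists i, (size i); split=> //; first exact: commutation_refl.
  by rewrite take_size.
have paths u : u \in D -> exists2 B, simple_word B /\ prefixes_in D B & u = rprod B.
  move=> /memD[j [k [cj ki ->]]].
  have [|B sB ej] := @commutation_class_simple A j sA; first by rewrite -eA.
  exists (take k B); last by rewrite ej /rprod map_take.
  split=> [a /mem_take/sB//|m]; rewrite -take_min; apply/memD.
  exists j, (minn m k); split=> //; first by rewrite (leq_trans (geq_minr _ _)).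
  by rewrite ej /rprod map_take.
have maxD : maximal_condorcet Phi P D.
  split=> // -[E [cE]]; rewrite fproperE.
  move=> /andP[/fsubsetP DE /fsubsetPn[w wE /negP]]; apply; apply/memD.
  rewrite szA eA; apply: (mem_prefix cE sA) => //.
  - by rewrite rA.
  - move=> B sB; rewrite rA => rB.
    rewrite -szA -(size_map (@refl R d) B); apply: mini; split; last by rewrite -rB.
    by move=> s /mapP[a /sB sa ->]; exists a.
  by move=> j k cj kA; apply: DE; apply/memD; exists j, k; rewrite szA eA.
split=> //; last by exists 1%:M; rewrite ?mul1mx.
move=> u v /paths[A1 [sA1 p1] ->] /paths[A2 [sA2 p2] ->].
have [_ down] := linked_prefixes sA1 p1; have [up _] := linked_prefixes sA2 p2.
exact: linked_trans down up.
Qed.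

(** The word from 1 to w0 that the monotone path spells is the reduced word of
    the tiling. *)
Lemma tiling_of_connected D w0 : longest Phi P w0 -> closed_condorcet Phi P D ->
  connected_domain Phi P D -> maximal_condorcet Phi P D -> 1%:M \in D -> w0 \in D ->
  tiling_type Phi P w0 D.
Proof.
move=> [_ Iw0] clD conD maxD eD w0D; have [cD _] := clD.
have [p [pD pp lp]] := conD _ _ eD w0D.
have [||||A [sA pA szA rA]] := monotone_path (A := [::]) clD w0D Iw0 eD pD pp lp.
- by [].
- by case=> [|k]; rewrite /= rprod_nil.
- rewrite add0n rprod_nil; congr (#|` _|); apply/fsetP => x; rewrite in_fsetD andbC.
  by have [Px|//] := boolP (x \in P); rewrite mem_inv1 ?pos_root // Px.
- by move=> x; rewrite rprod_nil.
have shortA B : simple_word B -> rprod B = w0 -> (size A <= size B)%N.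
  by move=> sB rB; rewrite szA size_longest_word // rB.
have sizeC j : commutation_class [seq refl a | a <- A] j -> size j = size A.
  by move/commutation_class_size; rewrite size_map.
have prefD j k :
    commutation_class [seq refl a | a <- A] j -> word_prod (take k j) \in D.
  move=> cj; have [B [_ -> pB]] := commutation_class_prefixes maxD sA pA cj.
  by rewrite -map_take; apply: pB.
split; first by case: cD.
exists [seq refl a | a <- A].
  split.
    split; last by rewrite -rA.
    by move=> s /mapP[a /sA sa ->]; exists a.
  by move=> j [/roots_of_word[B sB ->] eB]; rewrite !size_map; apply: shortA.
rewrite size_map => w; split; last by case=> j [k [cj _ ->]]; apply: prefD.
apply: (mem_prefix cD sA); first by rewrite rA.
  by move=> B sB; rewrite rA; apply: shortA.
by move=> j k cj _; apply: prefD.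
Qed.

End Weyl.

Theorem theorem1p9 (R : realType) (d : nat) (Phi P : {fset 'cV[R]_d})
    (w0 : 'M[R]_d) (D : {fset 'M[R]_d}) :
  root_system Phi ->
  positive_system Phi P ->
  longest Phi P w0 ->
  closed_condorcet Phi P D ->
  (tiling_type Phi P w0 D <->
   [/\ connected_domain Phi P D,
       maximal_width w0 D,
       maximal_condorcet Phi P D,
       1%:M \in D
     & w0 \in D]).
Proof.
move=> rootsPhi [l [l_neq0 PE]] lw0 clD; split.
  by apply: (tiling_properties rootsPhi l_neq0 PE lw0); case: clD.
by move=> [conD _ maxD eD w0D]; apply: (tiling_of_connected rootsPhi l_neq0 PE).
Qed.
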